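(* All formulae are concise in the class of icc groups; that is, for every formula $\varphi$ and every icc group $G$, if $G_\varphi$ is finite then $\varphi(G)$ is finite.
   Context: A formula is a first-order formula $\varphi(x)$ in the language of groups $\{1,\cdot,{}^{-1}\}$ with one free variable $x$ and without parameters. For a group $G$, $G_\varphi:=\{g\in G\mid\varphi(g)\text{ is true in }G\}$ and $\varphi(G):=\langle G_\varphi\rangle$. A formula $\varphi$ is concise in a class of groups if for every $G$ in the class, finiteness of $G_\varphi$ implies finiteness of $\varphi(G)$. A group is icc if the conjugacy class of every non-trivial element is infinite. *)

(* Defs.v *)
From HB Require Import structures.
From mathcomp Require Import all_boot.
From mathcomp Require Import boolp classical_sets functions cardinality.

Set Implicit Arguments.
Unset Strict Implicit.
Unset Printing Implicit Defensive.

Local Open Scope classical_set_scope.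
Local Open Scope group_scope.

(* First-order formulas in the language of groups {1, *, ^-1}, well scoped by
   construction: the free variables of a [gformula n] are among n variables,
   indexed by 'I_n, and quantifiers use de Bruijn indices, the variable bound
   by the innermost quantifier having index 0. There are no constants other
   than 1, hence no parameters. A formula phi(x) in one free variable is thus
   a [gformula 1]. *)
Inductive gterm (n : nat) : Type :=
| GVar of 'I_n
| GOne
| GMul of gterm n & gterm n
| GInv of gterm n.

Arguments GOne {n}.

Inductive gformula : nat -> Type :=
| GEq n of gterm n & gterm n : gformula n
| GNot n of gformula n : gformula n
| GAnd n of gformula n & gformula n : gformula n
| GOr n of gformula n & gformula n : gformula n
| GImplies n of gformula n & gformula n : gformula n
| GExists n of gformula n.+1 : gformula n
| GForall n of gformula n.+1 : gformula n.

Section Semantics.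
Variable G : groupType.

Fixpoint geval n (e : 'I_n -> G) (t : gterm n) : G :=
  match t with
  | GVar i => e i
  | GOne => 1
  | GMul t1 t2 => geval e t1 * geval e t2
  | GInv t1 => (geval e t1)^-1
  end.

Definition env_cons n (x : G) (e : 'I_n -> G) (i : 'I_n.+1) : G :=
  if unlift ord0 i is Some j then e j else x.

Fixpoint gholds n (f : gformula n) : ('I_n -> G) -> Prop :=
  match f in gformula m return ('I_m -> G) -> Prop with
  | GEq _ t1 t2 => fun e => geval e t1 = geval e t2
  | GNot _ f1 => fun e => ~ gholds f1 e
  | GAnd _ f1 f2 => fun e => gholds f1 e /\ gholds f2 e
  | GOr _ f1 f2 => fun e => gholds f1 e \/ gholds f2 e
  | GImplies _ f1 f2 => fun e => gholds f1 e -> gholds f2 e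
  | GExists _ f1 => fun e => exists x : G, gholds f1 (env_cons x e)
  | GForall _ f1 => fun e => forall x : G, gholds f1 (env_cons x e)
  end.

Definition definable_set (phi : gformula 1) : set G :=
  [set g | gholds phi (fun=> g)].

Definition subgroup_generated (A : set G) : set G :=
  smallest [set H : set G | group_closed [in H]] A.

Definition formula_subgroup (phi : gformula 1) : set G :=
  subgroup_generated (definable_set phi).

Definition conjugacy_class (x : G) : set G := [set conjg x y | y in setT].

End Semantics.

Arguments definable_set : clear implicits.
Arguments formula_subgroup : clear implicits.

Definition icc (G : groupType) : Prop :=
  forall x : G, x <> 1 -> infinite_set (conjugacy_class x).

Definition concise_in (C : groupType -> Prop) (phi : gformula 1) : Prop :=
  forall G : groupType, C G ->
    finite_set (definable_set G phi) -> finite_set (formula_subgroup G phi).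

(* Main.v *)
From HB Require Import structures.
Require Import Defs.
From mathcomp Require Import all_boot.
From mathcomp Require Import boolp classical_sets functions cardinality.

(* A definable set is invariant under automorphisms, so when it is finite all of
   its elements have finite conjugacy classes; in an icc group it is then
   contained in the trivial subgroup. *)

Set Implicit Arguments.
Unset Strict Implicit.
Unset Printing Implicit Defensive.

Local Open Scope classical_set_scope.
Local Open Scope group_scope.

(** Isomorphisms preserve the truth of parameter-free formulas ([gholds_iso]). Applied to
    conjugation, this makes the definable set a union of conjugacy classes
    ([conjugacy_class_definable]). If it is finite in an icc group, it contains no non-trivial
    element, so it generates the trivial subgroup. *)

Section Isomorphism.
Variables (G H : groupType) (f : UMagmaMorphism.type G H).

Lemma geval_morph n (e : 'I_n -> G) (t : gterm n) :
  geval (f \o e) t = f (geval e t).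
Proof.
elim: t => [i||t1 IH1 t2 IH2|t IH] //=; first by rewrite gmulf1.
  by rewrite gmulfM IH1 IH2.
by rewrite gmulfV IH.
Qed.

Lemma comp_env_cons n (x : G) (e : 'I_n -> G) :
  env_cons (f x) (f \o e) = f \o env_cons x e.
Proof. by apply/funext => i; rewrite /env_cons /=; case: unlift. Qed.

Hypothesis f_bij : bijective f.

(** Induction on [phi] for all [e], since quantifiers extend the environment. Injectivity of [f]
    reflects equations; surjectivity lets quantifiers over [H] be read in [G]. *)
Lemma gholds_iso n (phi : gformula n) (e : 'I_n -> G) :
  gholds phi (f \o e) <-> gholds phi e.
Proof.
have [g fK gK] := f_bij.
elim: phi e => {n} [n t1 t2|n p IH|n p IHp q IHq|n p IHp q IHq|n p IHp q IHq
  |n p IH|n p IH] e /=.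
- by rewrite !geval_morph; split=> [/(can_inj fK)|->].
- by rewrite IH.
- by rewrite IHp IHq.
- by rewrite IHp IHq.
- by rewrite IHp IHq.
- split=> [[y]|[x /IH px]]; last by exists (f x); rewrite comp_env_cons.
  by rewrite -[y]gK comp_env_cons => /IH; exists (g y).
- split=> p_e => [x|y]; first by apply/IH; rewrite -comp_env_cons.
  by rewrite -[y]gK comp_env_cons; apply/IH.
Qed.

Lemma definable_set_iso (phi : gformula 1) (x : G) :
  definable_set G phi x -> definable_set H phi (f x).
(* The constant environment at [f x] is, by conversion, [f] composed with the one at [x]. *)
Proof. by move=> /gholds_iso. Qed.

End Isomorphism.

(** Conjugation is named so that a morphism structure can be attached to it. *)
Definition inner_aut (G : groupType) (y x : G) : G := x ^ y.

Lemma inner_autF (G : groupType) (y : G) :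
  {morph inner_aut y : x z / x / z}.
Proof. by move=> x z; rewrite /inner_aut conjMg conjVg. Qed.

HB.instance Definition _ (G : groupType) (y : G) :=
  isGroupMorphism.Build G G (inner_aut y) (inner_autF y).

Lemma inner_aut_bij (G : groupType) (y : G) : bijective (inner_aut y).
Proof. by exists (inner_aut y^-1); [apply: conjgK|apply: conjgKV]. Qed.

Lemma conjugacy_class_definable (G : groupType) (phi : gformula 1) (x : G) :
  definable_set G phi x -> conjugacy_class x `<=` definable_set G phi.
Proof.
move=> phi_x _ [y _ <-].
exact: (definable_set_iso (f := inner_aut y) (inner_aut_bij y) phi_x).
Qed.

Lemma subgroup_generated_sub1 (G : groupType) (A : set G) :
  A `<=` [set 1] -> subgroup_generated A `<=` [set 1].
Proof.
(* The singleton of 1 is itself one of the subgroups over which the smallest is taken. *)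
move=> A1; apply: smallest_sub => //; split=> [|x y]; rewrite !inE //=.
by move=> -> ->; rewrite divg1.
Qed.

Theorem corollary2p5 (phi : gformula 1) : concise_in icc phi.
Proof.
move=> G iccG phi_fin.
apply: sub_finite_set (finite_set1 (1 : G)).
apply: subgroup_generated_sub1 => x phi_x /=; apply: contrapT => x1.
apply: (iccG x x1); apply: sub_finite_set phi_fin.
exact: conjugacy_class_definable.
Qed.
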